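(* Let $n\ge 16$ be an integer. Then $$ex(n,F_3)=\left\lfloor \frac{n^2}{3}\right\rfloor+1 \quad\text{and}\quad EX(n,F_3)=T_{3,n},$$ where the equality $EX(n,F_3)=T_{3,n}$ is understood up to isomorphism of digraphs.
   Context: Digraphs are finite and simple: there are no multiple arcs (at most one arc from $u$ to $v$ for each ordered pair $(u,v)$), but loops are allowed, and both $uv$ and $vu$ may be arcs. The order of a digraph is its number of vertices; its size is its number of arcs (loops are counted as arcs). A walk of length $k$ is a sequence of vertices $v_0v_1\cdots v_k$ (vertices may repeat) such that $v_{i-1}v_i$ is an arc for each $1\le i\le k$; $v_0$ is its initial vertex and $v_k$ its terminal vertex. $F_k$ is the family of digraphs consisting of two different walks of length $k$ with the same initial vertex and the same terminal vertex. A digraph is $F_k$-free if it contains no member of $F_k$ as a subgraph; that is, for all vertices $x,y$ (possibly $x=y$) there is at most one walk of length $k$ from $x$ to $y$ (equivalently, the $k$-th power of its adjacency matrix is a 0-1 matrix). $ex(n,F_k)$ is the maximum size of an $F_k$-free digraph of order $n$, and $EX(n,F_k)$ is the set of $F_k$-free digraphs of order $n$ with size $ex(n,F_k)$. For pairwise disjoint finite sets $V_1,V_2,V_3$, $T(V_1,V_2,V_3)$ is the digraph with vertex set $V_1\cup V_2\cup V_3$ in which $xy$ is an arc if and only if $x\in V_i$, $y\in V_j$ with $i<j$. $D+e$ denotes the digraph obtained from $D$ by adding an arc $e$ (not already in $D$), where $e$ is allowed to be a loop. $T_{3,n}$ is the set of digraphs $T(V_1,V_2,V_3)+e$ such that $|V_1|+|V_2|+|V_3|=n$,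 $|V_i|\in\{\lfloor n/3\rfloor,\lceil n/3\rceil\}$ for $i=1,2,3$, and $e$ is an arc (possibly a loop) with both ends in $V_2$. *)

(* Defs.v *)
From mathcomp Require Import all_boot.

Set Implicit Arguments.
Unset Strict Implicit.
Unset Printing Implicit Defensive.

(* Arcs form a set of ordered pairs: no multiple arcs, loops (x, x) allowed. *)
Record digraph := Digraph { vertex :> finType; arcs : {set vertex * vertex} }.

Definition order (D : digraph) : nat := #|vertex D|.

Definition size_dg (D : digraph) : nat := #|arcs D|.

(* A walk v_0 v_1 ... v_k of length k is a tuple of k + 1 vertices; [sorted e]
   says that e relates every two consecutive entries. *)
Definition walk (D : digraph) (k : nat) (w : k.+1.-tuple D) : bool :=
  sorted (fun x y : D => (x, y) \in arcs D) w.

Definition initial (D : digraph) (k : nat) (w : k.+1.-tuple D) : D :=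
  tnth w ord0.

Definition terminal (D : digraph) (k : nat) (w : k.+1.-tuple D) : D :=
  tnth w ord_max.

Definition F_free (k : nat) (D : digraph) : bool :=
  [forall w1 : k.+1.-tuple D, forall w2 : k.+1.-tuple D,
     [&& walk w1, walk w2, initial w1 == initial w2
       & terminal w1 == terminal w2] ==> (w1 == w2)].

(* Every digraph of order n is isomorphic to one with vertex set 'I_n, so the
   maximum is taken over the latter. The arcless digraph is F_k-free, so this
   is never the maximum of an empty family. *)
Definition ex (n k : nat) : nat :=
  \max_(A : {set 'I_n * 'I_n} | F_free k (Digraph A)) size_dg (Digraph A).

Definition EX (n k : nat) (D : digraph) : Prop :=
  [/\ order D = n, F_free k D & size_dg D = ex n k].

Definition T_arcs (V : finType) (V1 V2 V3 : {set V}) : {set V * V} :=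
  setX V1 V2 :|: setX V1 V3 :|: setX V2 V3.

(* n %/ 3 and n.+2 %/ 3 are the floor and the ceiling of n / 3. *)
Definition third (n m : nat) : bool := (m == n %/ 3) || (m == n.+2 %/ 3).

(* The added arc (u, v) is automatically new, since V2 is disjoint from V1 and
   V3 and so T(V1, V2, V3) has no arc inside V2. *)
Definition T3 (n : nat) (D : digraph) : Prop :=
  exists V1 V2 V3 : {set D},
    [/\ [/\ [disjoint V1 & V2], [disjoint V1 & V3] & [disjoint V2 & V3]],
        V1 :|: V2 :|: V3 = [set: D],
        #|V1| + #|V2| + #|V3| = n,
        [/\ third n #|V1|, third n #|V2| & third n #|V3|]
      & exists u v : D,
          [/\ u \in V2, v \in V2 & arcs D = (u, v) |: T_arcs V1 V2 V3]].

Definition isomorphic (D E : digraph) : Prop :=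
  exists2 f : D -> E, bijective f
    & forall x y : D, ((f x, f y) \in arcs E) = ((x, y) \in arcs D).

Definition eq_up_to_iso (P Q : digraph -> Prop) : Prop :=
  (forall D, P D -> exists2 E, Q E & isomorphic D E) /\
  (forall E, Q E -> exists2 D, P D & isomorphic D E).

(* Main.v *)
(** For the upper bound, let [S] be the set of sinks, [W] its complement, [u] a
    vertex of [W] with the most out-neighbours in [W], [N] the set of these
    out-neighbours, and [t] the number of walks of length 2 from [u] inside
    [W]. Those walks end at distinct vertices, whose out-neighbourhoods are
    pairwise disjoint, since every vertex of [W] can be prolonged. Hence at
    most [t + |W \ N| |N|] arcs lie inside [W], and at most
    [|S| + (|W| - t) |S|] go from [W] to [S]. If [S] is nonempty and [t > 0],
    these add up to at most [|W \ N| |N| + |W| |S| + 1], with three parts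
    [W \ N], [N], [S]; equality forces [t = 1] and the structure
    T(V1, V2, V3) + e. If [t = 0], the term [+ 1] disappears; if [S] is empty,
    there are at most [n + n^2 / 4] arcs. *)
Require Import Defs.
From mathcomp Require Import all_boot zify.

Set Implicit Arguments.
Unset Strict Implicit.
Unset Printing Implicit Defensive.

(** * Sums of set sizes *)

Lemma sum_card_disjoint (I T : finType) (A : {set I}) (F : I -> {set T}) :
  (forall i j x, i \in A -> j \in A -> x \in F i -> x \in F j -> i = j) ->
  \sum_(i in A) #|F i| = #|\bigcup_(i in A) F i|.
Proof.
move=> disjF; under eq_bigr do rewrite -sum1_card big_mkcond /=.
rewrite exchange_big -sum1_card [RHS]big_mkcond; apply: eq_bigr => x _.
case: bigcupP => [[i iA xFi] | nox].
  rewrite (bigD1 i) //= xFi big1 // => j /andP[jA /eqP ji].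
  by case: ifP => // xFj; case: ji; apply: disjF xFj xFi.
rewrite big1 // => i iA; case: ifP => // xFi; case: nox; by exists i.
Qed.

(** Turns a tight total count into exact information on each single vertex. *)
Lemma sum_card_saturated (I : finType) (A : {set I}) (F : I -> nat) k :
  (forall i, i \in A -> F i <= k) -> #|A| * k <= \sum_(i in A) F i ->
  forall i, i \in A -> F i = k.
Proof.
move=> leFk le_sum i iA; apply/eqP; rewrite eqn_leq leFk //= leqNgt.
apply/negP => ltFk; move: le_sum; rewrite leqNgt => /negP; apply.
rewrite -sum_nat_const (bigD1 i) // [X in _ < X](bigD1 i) //= -addSn.
by apply: leq_add => //; apply: leq_sum => j /andP[/leFk].
Qed.

Lemma leq_sum_card_const (I : finType) (A : {set I}) (F : I -> nat) k :
  (forall i, i \in A -> F i <= k) -> \sum_(i in A) F i <= #|A| * k.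
Proof. by move=> leFk; rewrite -sum_nat_const; apply: leq_sum. Qed.

(** * Sums of products over three balanced parts *)

Lemma leq_three_products a b c :
  a * b + a * c + b * c <= (a + b + c) ^ 2 %/ 3.
Proof.
rewrite leq_divRL //.
case: (leqP a b) => ?; case: (leqP b c) => ?; case: (leqP a c) => ?; nia.
Qed.

(** The square minus three times the left side is half the sum of the squared differences, here at
    least [(4 + 1 + 1) / 2 = 3], so strictness survives the division by 3. *)
Lemma three_products_gap a b c : a.+2 <= c ->
  a * b + a * c + b * c < (a + b + c) ^ 2 %/ 3.
Proof.
move=> /subnKC <-; rewrite leq_divRL //; move: (c - a.+2) => k.
have [/subnKC <- | /ltnW/subnKC <-] := leqP a b.
  by move: (b - a) => l; case: (leqP l k.+1) => ?; nia.
by move: (a - b) => l; nia.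
Qed.

Lemma eq_three_products a b c n : a + b + c = n ->
  a * b + a * c + b * c = n ^ 2 %/ 3 <->
  [/\ third n a, third n b & third n c].
Proof.
move=> abcn; rewrite /third; split=> [eq3 | ].
  have gap x y z : x + y + z = n -> x * y + x * z + y * z = n ^ 2 %/ 3 ->
      z <= x.+1.
    move=> <- xyz; rewrite leqNgt; apply/negP => /(three_products_gap y).
    by rewrite xyz ltnn.
  have := gap a b c; have := gap c b a; have := gap b a c.
  have := gap c a b; have := gap a c b; have := gap b c a.
  rewrite ![c * _]mulnC [b * a]mulnC.
  move: (a * b) (a * c) (b * c) (n ^ 2 %/ 3) eq3 => p q r s eq3.
  by do 6 (move=> /(_ ltac:(lia) ltac:(lia)) ?); split; lia.
(* With parts [m] or [m.+1] that half sum is at most 1, too small to change the quotient. *)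
move=> [a3 b3 c3]; apply/eqP; rewrite eqn_leq -{1}abcn leq_three_products /=.
rewrite -ltnS ltn_divLR //.
have [m [am bm cm]] : exists m,
    [/\ a = m \/ a = m.+1, b = m \/ b = m.+1 & c = m \/ c = m.+1].
  by exists (n %/ 3); split; lia.
rewrite -abcn {a3 b3 c3 abcn}.
by case: am => ->; case: bm => ->; case: cm => ->; rewrite expnS expn1; lia.
Qed.

(** Two sinks force [t = 1]; two vertices in the middle part forbid arcs into the first part. *)
Lemma third_gt1 n m : 16 <= n -> third n m -> 1 < m.
Proof. by rewrite /third; lia. Qed.

(** Meant for [t = #|R|], [z = #|W :\: R|], [s = #|sinks|]. Substituting [z = a + b - t] into the
    summed bounds leaves the excess [t + s - t s = 1 - (t - 1)(s - 1)]; at [t = 1] equality leaves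
    no slack in any bound. *)
Lemma count_arcs m a b s t z A B C :
  m = t + A + (B + C) -> A <= a * b -> B <= s -> C <= z * s ->
  a + b = t + z -> (t = 0 -> B = 0) -> 0 < s ->
  [/\ m + t.-1 * s.-1 <= a * b + a * s + b * s + 1,
      t = 0 -> m <= a * b + a * s + b * s
    & m = a * b + a * s + b * s + 1 -> t = 1 ->
      a * b <= A /\ (t + z) * s <= B + C].
Proof.
move=> mE leA leB leC abtz B0 s_gt0.
have abtz_s : a * s + b * s = t * s + z * s by rewrite -!mulnDl abtz.
have [t0 | t_gt0] := posnP t.
  by have := B0 t0; rewrite t0 in abtz_s mE *; split; lia.
have -> : t.-1 * s.-1 = t * s + 1 - t - s.
  by case: t s t_gt0 s_gt0 {mE abtz leC leB B0 abtz_s} => // t [] // s _ _; lia.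
by split=> [|t0|mE' t1]; [nia | lia | rewrite t1 in abtz_s mE *; lia].
Qed.

(** * Walks of length 3 and arcs of a fixed digraph *)

Section Digraph.

Variable D : digraph.

Let e (x y : D) := (x, y) \in arcs D.

Lemma F_free3P :
  reflect (forall x a b a' b' y : D,
             e x a -> e a b -> e b y -> e x a' -> e a' b' -> e b' y ->
             a = a' /\ b = b')
          (F_free 3 D).
Proof.
apply: (iffP forallP) => [free x a b a' b' y xa ab b_y xa' ab' b_y' | free w].
  move: (free [tuple x; a; b; y]) => /forallP/(_ [tuple x; a'; b'; y])/implyP.
  rewrite /walk /initial /terminal /= !(tnth_nth x) /= !eqxx !andbT.
  rewrite -!/(e _ _) xa ab b_y xa' ab' b_y' => /(_ isT)/eqP/(congr1 val) /=.
  by case.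
apply/forallP => w'; apply/implyP => /and4P[].
case: w => -[|x [|a [|b [|y [|? ?]]]]] //= w_sz.
case: w' => -[|x' [|a' [|b' [|y' [|? ?]]]]] //= w'_sz.
rewrite /walk /initial /terminal /= !(tnth_nth x) /= !andbT.
move=> /and3P[xa ab b_y] /and3P[xa' ab' b_y'] /eqP ? /eqP ?; subst x' y'.
have [? ?] := free _ _ _ _ _ _ xa ab b_y xa' ab' b_y'; subst a' b'.
exact/eqP/val_inj.
Qed.

Lemma size_dg_sum : size_dg D = \sum_x #|[set y | e x y]|.
Proof.
rewrite /size_dg -sum1_card (eq_bigl (fun p => e p.1 p.2)); last by case.
rewrite -(pair_big_dep xpredT e (fun _ _ => 1)) /=; apply: eq_bigr => x _.
by rewrite sum1_card cardsE.
Qed.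

(** * The upper bound and its equality case *)

Section UpperBound.

Hypothesis free : F_free 3 D.
Hypothesis hn : 16 <= #|D|.

Let sinks := [set x | [forall y, ~~ e x y]].
Let W := ~: sinks.
Let outW x := [set y in W | e x y].
Let outS x := [set y in sinks | e x y].

Let in_outW x y : (y \in outW x) = (y \in W) && e x y.
Proof. by rewrite inE. Qed.

Let in_outS x y : (y \in outS x) = (y \in sinks) && e x y.
Proof. by rewrite inE. Qed.

Let outP x : reflect (exists y, e x y) (x \in W).
Proof.
rewrite !inE negb_forall; apply: (iffP existsP) => -[y xy]; exists y => //.
  by rewrite negbK in xy.
by rewrite negbK.
Qed.

Let size_W : size_dg D = \sum_(x in W) #|outW x| + \sum_(x in W) #|outS x|.
Proof.
rewrite size_dg_sum -big_split [RHS]big_mkcond /=; apply: eq_bigr => x _.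
case: ifPn => [_ | /outP no_out].
  rewrite -(cardsID W [set y | e x y]); congr (_ + _); apply: eq_card => y.
    by rewrite !inE andbC.
  by rewrite !inE negbK andbC.
apply: eq_card0 => y; rewrite inE; apply/negP => xy; apply: no_out; by exists y.
Qed.

(** An arc out of [w] prolongs both walks to length 3. *)
Let walk2_inj x v w v' : w \in W ->
  e x v -> e v w -> e x v' -> e v' w -> v = v'.
Proof.
move=> /outP[y wy] xv vw xv' vw'.
by have [] := F_free3P free _ _ _ _ _ _ xv vw wy xv' vw' wy.
Qed.

Lemma upper_bound_T3 :
  size_dg D <= #|D| ^ 2 %/ 3 + 1 /\
  (size_dg D = #|D| ^ 2 %/ 3 + 1 -> T3 #|D| D).
Proof.
have [W0 | [u0 u0W]] := set_0Vmem W.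
  by rewrite size_W W0 !big_set0; split => [//|]; lia.
pose u := [arg max_(x > u0 in W) #|outW x|].
have [uW maxu] : u \in W /\ forall x, x \in W -> #|outW x| <= #|outW u|.
  by rewrite /u; case: arg_maxnP.
pose N := outW u; pose R := \bigcup_(v in N) outW v.
have NW : N \subset W by apply/subsetP => x; rewrite in_outW => /andP[].
have RW : R \subset W.
  by apply/bigcupsP => v _; apply/subsetP => x; rewrite in_outW => /andP[].
have outN v : v \in N -> v \in W /\ e u v by rewrite in_outW => /andP[].
(* By [walk2_inj] the sets [outW v] are disjoint, so [#|R|] counts the walks of length 2 from [u]
   inside [W]. *)
have sumN : \sum_(v in N) #|outW v| = #|R|.
  apply: sum_card_disjoint => v v' w /outN[_ uv] /outN[_ uv'].
  rewrite !in_outW => /andP[wW vw] /andP[_ vw'].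
  exact: walk2_inj wW uv vw uv' vw'.
have sumWN : \sum_(x in W :\: N) #|outW x| <= #|W :\: N| * #|N|.
  by apply: leq_sum_card_const => x /setDP[/maxu].
have out_sinks x : #|outS x| <= #|sinks|.
  by apply: subset_leq_card; apply/subsetP => y; rewrite in_outS => /andP[].
(* A sink reached from two vertices of [R] would end two walks of length 3 from [u]. *)
have sumR : \sum_(w in R) #|outS w| <= #|sinks|.
  rewrite sum_card_disjoint.
    apply: subset_leq_card; apply/bigcupsP => w _; apply/subsetP => y.
    by rewrite in_outS => /andP[].
  move=> w w' y /bigcupP[v /outN[_ uv] vw] /bigcupP[v' /outN[_ uv'] vw'].
  move: vw vw'; rewrite !in_outW !in_outS.
  move=> /andP[_ vw] /andP[_ vw'] /andP[_ wy] /andP[_ w'y].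
  by have [] := F_free3P free _ _ _ _ _ _ uv vw wy uv' vw' w'y.
have sumWR : \sum_(x in W :\: R) #|outS x| <= #|W :\: R| * #|sinks|.
  by apply: leq_sum_card_const => x _.
have splitW (A : {set D}) (F : D -> nat) : A \subset W ->
    \sum_(x in W) F x = \sum_(x in A) F x + \sum_(x in W :\: A) F x.
  by move=> AW; rewrite (big_setID A) (setIidPr AW).
have cardW (A : {set D}) : A \subset W -> #|W| = #|A| + #|W :\: A|.
  by move=> AW; rewrite -(cardsID A W) (setIidPr AW).
have cardD : #|W :\: N| + #|N| + #|sinks| = #|D|.
  by rewrite -(cardsC sinks) (cardW _ NW); lia.
have bound := leq_three_products #|W :\: N| #|N| #|sinks|.
have e_le := size_W.
rewrite (splitW _ _ NW) sumN (splitW _ _ RW) in e_le.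
have {cardW} [cWN cWR] := (cardW _ NW, cardW _ RW).
rewrite cardD in bound.
have [s0 | s_gt0] := posnP #|sinks|.
  have RD : #|R| <= #|D| by apply: max_card.
  (* This is below the extremal value, so the equality case is void. *)
  suff: size_dg D <= #|D| ^ 2 %/ 3 by lia.
  rewrite s0 muln0 addn0 in sumR sumWR cardD.
  have {e_le} : size_dg D <= #|D| + #|W :\: N| * #|N| by lia.
  have := hn; rewrite -cardD; move: #|W :\: N| #|N| => a b ab16 /leq_trans-> //.
  rewrite leq_divRL //; have [agm _] := nat_AGM2 a b.
  by move: (a * b) (a + b) agm ab16 => q s agm s16; nia.
have R0 : #|R| = 0 -> \sum_(w in R) #|outS w| = 0.
  by move=> /cards0_eq->; rewrite big_set0.
have cardW2 : #|W :\: N| + #|N| = #|R| + #|W :\: R| by rewrite addnC -cWN.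
have [e_le3 e_0 e_eq] := count_arcs e_le sumWN sumR sumWR cardW2 R0 s_gt0.
split.
  by rewrite (leq_trans _ (leq_add bound (leqnn 1))) // (leq_trans _ e_le3) ?leq_addr.
move=> eD; rewrite eD in e_le3 e_0 e_eq.
(* The extremal size squeezes the sum of products from below, [bound] from above. *)
have eq3 : #|W :\: N| * #|N| + #|W :\: N| * #|sinks| + #|N| * #|sinks|
           = #|D| ^ 2 %/ 3.
  apply/eqP; rewrite eqn_leq bound -(leq_add2r 1) (leq_trans _ e_le3) //.
  exact: leq_addr.
rewrite eq3 in e_le3 e_0 e_eq.
have /eqP : #|R|.-1 * #|sinks|.-1 = 0.
  by apply/eqP; rewrite -leqn0 -(leq_add2l (#|D| ^ 2 %/ 3 + 1)) addn0.
rewrite muln_eq0 => ts0.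
(* The predecessor [#|R|.-1] also vanishes when [R] is empty; there the bound lacks its [+ 1]. *)
have t_gt0 : 0 < #|R|.
  by rewrite lt0n; apply/eqP => /e_0; rewrite addn1 ltnn.
have [thirdV1 thirdN thirdS] := (eq_three_products cardD).1 eq3.
have s_gt1 : 1 < #|sinks| := third_gt1 hn thirdS.
have N_gt1 : 1 < #|N| := third_gt1 hn thirdN.
have t1 : #|R| = 1.
  by case/orP: ts0 => /eqP; clear -t_gt0 s_gt1; lia.
have [sat1 sat2] := e_eq erefl t1.
have W_to_S x y : x \in W -> y \in sinks -> e x y.
  move=> xW yS; have: y \in outS x.
    have /eqP -> // : outS x == sinks.
    rewrite eqEcard; apply/andP; split.
      by apply/subsetP => z; rewrite in_outS => /andP[].
    rewrite (sum_card_saturated (F := fun x => #|outS x|) _ _ xW (k := #|sinks|)) //.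
    by rewrite cWR (splitW _ _ RW).
  by rewrite in_outS => /andP[].
(* One common sink prolongs both walks to length 3 with the same end. *)
have walk2_uniq x v w v' w' : w \in W -> w' \in W ->
    e x v -> e v w -> e x v' -> e v' w' -> w = w'.
  move=> wW wW' xv vw xv' vw'; have /card_gt0P[y yS] := s_gt0.
  by have [] := F_free3P free _ _ _ _ _ _ xv vw (W_to_S _ _ wW yS)
                  xv' vw' (W_to_S _ _ wW' yS).
have outW_card x : x \in W :\: N -> #|outW x| = #|N|.
  move=> xV1; apply: (sum_card_saturated (F := fun x => #|outW x|) _ sat1 xV1).
  by move=> y /setDP[/maxu].
(* Otherwise [y] has [#|N| > 1] out-neighbours in [W], against [walk2_uniq]. *)
have no_arc_to_V1 x y : x \in W -> e x y -> y \notin W :\: N.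
  move=> xW xy; apply/negP => /outW_card eqN.
  have /card_gt1P[w [w' [+ + /eqP]]] : 1 < #|outW y| by rewrite eqN.
  rewrite !in_outW => /andP[wW yw] /andP[wW' yw'] [].
  exact: (walk2_uniq x y w y w').
have outV1 x : x \in W :\: N -> outW x = N.
  move=> xV1; apply/eqP; rewrite eqEcard outW_card // leqnn andbT.
  apply/subsetP => y; rewrite in_outW => /andP[yW xy].
  have /setDP[xW _] := xV1.
  by have := no_arc_to_V1 _ _ xW xy; rewrite in_setD yW andbT negbK.
(* The only walk of length 2 from [u] inside [W] is [u p q]; its last arc is the added one. *)
have /eqP/cards1P[q Rq] := t1.
have /bigcupP[p pN] : q \in R by rewrite Rq set11.
rewrite in_outW => /andP[qW pq].
have [pW up] := outN _ pN.
have qN : q \in N.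
  by have := no_arc_to_V1 _ _ pW pq; rewrite in_setD qW andbT negbK.
exists (W :\: N), N, sinks; split => //.
- by rewrite disjoint_sym !disjoints_subset setCD subsetUr subsetDl NW.
- apply/setP => x; rewrite !in_setU in_setD in_setT.
  have -> : (x \in sinks) = (x \notin W) by rewrite in_setC negbK.
  by case: (boolP (x \in N)) => [/(subsetP NW)-> | _]; case: (x \in W).
exists p, q; split => //; apply/setP => -[x y].
rewrite in_setU1 xpair_eqE /T_arcs !in_setU !in_setX -/(e x y).
apply/idP/idP => [xy | ].
  have xW : x \in W by apply/outP; exists y.
  have [yS | yW] := boolP (y \in sinks).
    by rewrite in_setD xW !andbT; case: (x \in N); rewrite !orbT.
  rewrite -in_setC -/W in yW.
  have [xN | xN] := boolP (x \in N).
    have [_ ux] := outN _ xN.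
    have: y \in R by apply/bigcupP; exists x; rewrite // in_outW yW.
    rewrite Rq inE => /eqP yq; subst y.
    by rewrite (walk2_inj qW ux xy up pq) !eqxx.
  have xV1 : x \in W :\: N by rewrite in_setD xN.
  have : y \in outW x by rewrite in_outW yW.
  by rewrite outV1 // => yN; rewrite xV1 yN orbT.
case/orP => [/andP[/eqP-> /eqP->] // | /orP[/orP[] | ] /andP[]].
- by move=> xV1; rewrite -(outV1 _ xV1) in_outW => /andP[].
- by move=> /setDP[xW _]; apply: W_to_S.
- by move=> /outN[xW _]; apply: W_to_S.
Qed.

End UpperBound.

(** * Members of [T3] attain the bound *)

Lemma T3_extremal n :
  T3 n D -> [/\ Defs.order D = n, F_free 3 D & size_dg D = n ^ 2 %/ 3 + 1].
Proof.
move=> [V1 [V2 [V3 [[d12 d13 d23] cover cardV [t1 t2 t3] [u [v [uV2 vV2 eD]]]]]]].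
have notin (A B : {set D}) x : [disjoint A & B] -> x \in A -> x \in B -> False.
  by move=> /disjointFr dAB /dAB ->.
split.
- rewrite /Defs.order -cardsT -cover -cardV !cardsU disjoint_setI0 // cards0 subn0.
  by rewrite setIUl !disjoint_setI0 // setU0 cards0 subn0.
(* The middle arc of every walk of length 3 is the added arc, so the ends determine the walk. *)
- have arcE x y : e x y -> [\/ (x, y) = (u, v), x \in V1 /\ y \in V2,
                               x \in V1 /\ y \in V3 | x \in V2 /\ y \in V3].
    rewrite /e eD in_setU1 => /orP[/eqP -> | ]; first by constructor 1.
    rewrite /T_arcs !in_setU !in_setX => /orP[/orP[] | ] /andP[];
    by [constructor 2 | constructor 3 | constructor 4].
  (* [a] has an in-arc and [b] an out-arc, so that both lie in V2. *)
  have middle x a b y : e x a -> e a b -> e b y -> (a, b) = (u, v).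
    move=> /arcE xa /arcE ab /arcE b_y; have {xa} aV1 : a \notin V1.
      apply/negP => aV1; case: xa => [[_ av] | [] _ ? | [] _ ? | [] _ ?];
      by [apply: notin d12 aV1 _; rewrite ?av | apply: notin d13 aV1 _].
    have {b_y} bV3 : b \notin V3.
      apply/negP => bV3; case: b_y => [[bu _] | [] ? _ | [] ? _ | [] ? _];
      by [apply: notin d23 _ bV3; rewrite ?bu | apply: notin d13 _ bV3].
    by case: ab aV1 bV3 => // -[aV bV]; rewrite ?aV ?bV.
  apply/F_free3P => x a b a' b' y xa ab b_y xa' ab' b_y'.
  by have := middle _ _ _ _ xa ab b_y; rewrite -(middle _ _ _ _ xa' ab' b_y') => -[].
have disjX (A B A' B' : {set D}) : [disjoint A & A'] \/ [disjoint B & B'] ->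
    setX A B :&: setX A' B' = set0.
  move=> dAB; apply/setP => -[x y]; rewrite !inE.
  apply/negP => /andP[/andP[? ?] /andP[? ?]].
  by case: dAB => d; apply: notin d _ _; eassumption.
have new_arc : (u, v) \notin T_arcs V1 V2 V3.
  rewrite /T_arcs !in_setU !in_setX uV2 vV2 (disjointFl d12 uV2).
  by rewrite (disjointFr d23 vV2).
rewrite /size_dg eD cardsU1 new_arc addnC /T_arcs !cardsU setIUl.
by rewrite !disjX ?setU0 ?cards0 ?subn0 ?cardsX ?((eq_three_products cardV).2 _); auto.
Qed.

End Digraph.

(** * Existence of extremal digraphs and conclusion *)

Lemma card_ord_lt n k : k <= n -> #|[set i : 'I_n | i < k]| = k.
Proof.
move=> kn; rewrite cardsE -sum1_card -[RHS]card_ord -[RHS]sum1_card.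
by rewrite (big_ord_widen n (fun=> 1) kn).
Qed.

Lemma T3_exists n : 16 <= n -> exists A : {set 'I_n * 'I_n}, T3 n (Digraph A).
Proof.
(* The intervals cut at [k1] and [k2] have sizes [n %/ 3], [n.+1 %/ 3], [n.+2 %/ 3], which sum to
   [n]; the added arc is a loop at vertex [k1]. *)
move=> hn; pose k1 := n %/ 3; pose k2 := k1 + n.+1 %/ 3.
have k1n : k1 <= n by lia.
have k2n : k2 <= n by lia.
have k21 : k1 < k2 by lia.
pose X1 := [set i : 'I_n | i < k1]; pose X2 := [set i : 'I_n | i < k2].
have X12 : X1 \subset X2.
  by apply/subsetP => i; rewrite !inE => /ltn_trans; apply.
pose v := Ordinal (leq_trans k21 k2n).
exists ((v, v) |: T_arcs X1 (X2 :\: X1) (~: X2)), X1, (X2 :\: X1), (~: X2).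
have card1 : #|X1| = k1 by apply: card_ord_lt.
have card2 : #|X2 :\: X1| = n.+1 %/ 3.
  by rewrite cardsD (setIidPr X12) !card_ord_lt // addKn.
have card3 : #|~: X2| = n.+2 %/ 3.
  by rewrite cardsCs setCK card_ord card_ord_lt // /k2 /k1; lia.
split.
- by rewrite !disjoints_subset setCD setCK subsetUr subsetDl X12.
- by rewrite setDE setUIr setUCr setIT (setUidPr X12) setUCr.
- by rewrite card1 card2 card3; lia.
- by rewrite card1 card2 card3 /third; split; lia.
by exists v, v; rewrite !inE /= ltnn k21.
Qed.

Lemma ex3E n : 16 <= n -> ex n 3 = n ^ 2 %/ 3 + 1.
Proof.
move=> hn; apply/eqP; rewrite eqn_leq; apply/andP; split.
  apply/bigmax_leqP => A free.
  by have [] := upper_bound_T3 free; rewrite ?card_ord.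
have [A /T3_extremal[_ free <-]] := T3_exists hn.
exact: leq_bigmax_cond.
Qed.

Lemma EX3P n (D : digraph) : 16 <= n -> EX n 3 D <-> T3 n D.
Proof.
move=> hn; rewrite /EX ex3E //; split=> [[nD free sz] | /T3_extremal //].
by subst n; have [_] := upper_bound_T3 free hn; apply.
Qed.

Theorem theorem2 (n : nat) (hn : 16 <= n) :
  ex n 3 = n ^ 2 %/ 3 + 1 /\ eq_up_to_iso (EX n 3) (T3 n).
Proof.
split; first exact: ex3E.
(* Both families contain the same digraphs, so the identity is isomorphism enough. *)
have isoD (D : digraph) : isomorphic D D by exists id => //; exists id.
by split=> D /(EX3P _ hn) PD; exists D.
Qed.
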